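(* Let $(B,+,\circ)$ be a Dedekind skew brace such that $\operatorname{Soc}_2(B)=B$ and $(B,+)$ is not periodic. Then: (1) $\operatorname{Soc}(B)=Z(B)$, so $B=Z_2(B)$. (2) $(B\ast B,+)$ is locally cyclic and periodic. (3) $B$ embeds into the direct product $S\times T$ of skew braces $S$ and $T$, where $(T,+)$ is periodic, $(T\ast T,+)$ is locally cyclic, and $S$ is a trivial skew brace with torsion-free additive group.
   Context: A skew brace is a triple $(B,+,\circ)$ with $(B,+)$, $(B,\circ)$ (not necessarily abelian) groups such that $a\circ(b+c)=a\circ b-a+a\circ c$ for all $a,b,c\in B$. The identities of the two groups coincide and are denoted by $0$. For $a\in B$ put $\lambda_a(b)=-a+a\circ b$; then $\lambda:a\mapsto\lambda_a$ is a homomorphism $(B,\circ)\to\operatorname{Aut}(B,+)$. Put $a\ast b=-a+a\circ b-b$, and let $B\ast B$ be the subgroup of $(B,+)$ generated by all $a\ast b$ with $a,b\in B$ (it is an ideal). A sub-skew brace is a subset that is a subgroup of both $(B,+)$ and $(B,\circ)$. An ideal is a subgroup of $(B,+)$ that is normal in $(B,+)$, invariant under all $\lambda_b$, and normal in $(B,\circ)$; one can form the quotient skew brace $B/I$. $B$ is Dedekind if all its sub-skew braces are ideals of $B$. $B$ is trivial if $a+b=a\circ b$ for all $a,b\in B$. Skew brace homomorphisms preserve both operations; an embedding is an injective homomorphism. The socle is $\operatorname{Soc}(B)=\operatorname{Ker}(\lambda)\cap Z(B,+)$ and the centre is $Z(B)=\operatorname{Soc}(B)\cap Z(B,\circ)$;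 both are ideals. $\operatorname{Soc}_2(B)$ and $Z_2(B)$ are the ideals of $B$ defined by $\operatorname{Soc}_2(B)/\operatorname{Soc}(B)=\operatorname{Soc}(B/\operatorname{Soc}(B))$ and $Z_2(B)/Z(B)=Z(B/Z(B))$. A group is periodic if all its elements have finite order, and locally cyclic if every finitely generated subgroup is cyclic. *)

(* Defs.v *)
From HB Require Import structures.
From mathcomp Require Import all_boot.
From mathcomp Require Import boolp classical_sets cardinality.

Set Implicit Arguments.
Unset Strict Implicit.
Unset Printing Implicit Defensive.

Local Open Scope classical_set_scope.
Local Open Scope group_scope.

Section Groups.
Variable G : groupType.
Implicit Types (H A : set G).

Definition subgroup H :=
  [/\ H 1, forall x y, H x -> H y -> H (x * y) & forall x, H x -> H x^-1].

Definition normal_subgroup H :=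
  subgroup H /\ forall x y, H x -> H (x ^ y).

Definition generated A : set G := smallest subgroup A.

Definition group_centre : set G := [set x | forall y, commute x y].

Definition cyclic_subgroup H := exists x, H = generated [set x].

Definition locally_cyclic H :=
  forall A, finite_set A -> A `<=` H -> cyclic_subgroup (generated A).

Definition periodic H := forall x, H x -> exists2 n, (0 < n)%N & x ^+ n = 1.

Definition torsion_free H :=
  forall x n, H x -> (0 < n)%N -> x ^+ n = 1 -> x = 1.

End Groups.

(* The groupType structure of a skew brace is its additive group (B,+), which
   need not be abelian; it is displayed additively in skew_scope. The group
   (B,o) is a second groupType, [circ_group B], on a copy of the carrier. A
   choiceType carrier is no restriction, classically. *)
Declare Scope skew_scope.
Delimit Scope skew_scope with skew.
Notation "0" := (@monoid.one _) : skew_scope.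
Notation "x + y" := (monoid.mul x y) : skew_scope.
Notation "- x" := (monoid.inv x) : skew_scope.
Notation "x - y" := (monoid.mul x (monoid.inv y)) : skew_scope.

HB.mixin Record isSkewBrace B of Group B := {
  circ : B -> B -> B;
  circ_one : B;
  circ_inv : B -> B;
  circA : associative circ;
  circ1b : left_id circ_one circ;
  circb1 : right_id circ_one circ;
  circVb : left_inverse circ_one circ_inv circ;
  circbV : right_inverse circ_one circ_inv circ;
  circDr : forall a b c : B,
    circ a (b + c)%skew = (circ a b - a + circ a c)%skew
}.

#[short(type="skewBraceType")]
HB.structure Definition SkewBrace := {B of isSkewBrace B & Group B}.

Notation "x ∘ y" := (circ x y) (at level 40, left associativity) : skew_scope.

Definition circ_type (B : Type) : Type := B.
HB.instance Definition _ (B : skewBraceType) := Choice.on (circ_type B).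
HB.instance Definition _ (B : skewBraceType) :=
  isGroup.Build (circ_type B)
    (@circA B) (@circ1b B) (@circb1 B) (@circVb B) (@circbV B).
Definition circ_group (B : skewBraceType) : groupType := circ_type B.

Local Open Scope skew_scope.

Section SkewBraces.
Variable B : skewBraceType.
Implicit Types (a b : B) (A I : set B).

Definition lambda a b : B := - a + a ∘ b.

Definition star a b : B := - a + a ∘ b - b.

Definition star_sub : set B := generated [set star p.1 p.2 | p in [set: B * B]].

Definition sub_skew_brace A := subgroup A /\ @subgroup (circ_group B) A.

Definition ideal I :=
  [/\ normal_subgroup I,
      forall b x, I x -> I (lambda b x)
    & @normal_subgroup (circ_group B) I].

Definition dedekind := forall A, sub_skew_brace A -> ideal A.

Definition trivial_skew_brace := forall a b, a + b = a ∘ b.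

Definition ker_lambda : set B := [set a | forall b, lambda a b = b].

Definition Soc : set B := ker_lambda `&` @group_centre B.

Definition centre : set B := Soc `&` @group_centre (circ_group B).

End SkewBraces.

Arguments star_sub : clear implicits.
Arguments dedekind : clear implicits.
Arguments trivial_skew_brace : clear implicits.
Arguments ker_lambda : clear implicits.
Arguments Soc : clear implicits.
Arguments centre : clear implicits.

Definition skew_brace_hom (B C : skewBraceType) (f : B -> C) :=
  {morph f : x y / x + y} /\ {morph f : x y / x ∘ y}.

Definition embedding (B C : skewBraceType) (f : B -> C) :=
  skew_brace_hom f /\ injective f.


Section BasicFacts.
Variable B : skewBraceType.
Implicit Types a b c x y : B.

Lemma circ_oneE : @circ_one B = 0.
Proof.
have /= E := @circDr B circ_one 0 0.
rewrite mulg1 !circ1b mulg1 mul1g in E.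
by rewrite -[LHS]invgK -E invg1.
Qed.

Lemma circ0b b : 0 ∘ b = b. Proof. by rewrite -circ_oneE circ1b. Qed.

Lemma circb0 b : b ∘ 0 = b. Proof. by rewrite -circ_oneE circb1. Qed.

Lemma circVb0 b : circ_inv b ∘ b = 0. Proof. by rewrite circVb circ_oneE. Qed.

Lemma circbV0 b : b ∘ circ_inv b = 0. Proof. by rewrite circbV circ_oneE. Qed.

Lemma circE a b : a ∘ b = a + lambda a b.
Proof. by rewrite /lambda mulVKg. Qed.

Lemma lambdaD a b c : lambda a (b + c) = lambda a b + lambda a c.
Proof. by rewrite /lambda circDr !mulgA. Qed.

Lemma lambda_r0 a : lambda a 0 = 0.
Proof. by rewrite /lambda circb0 mulVg. Qed.

Lemma lambdaN a b : lambda a (- b) = - lambda a b.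
Proof. by apply: (mulgI (lambda a b)); rewrite -lambdaD !mulgV lambda_r0. Qed.

Lemma lambda_circ a b c : lambda (a ∘ b) c = lambda a (lambda b c).
Proof.
rewrite {3}/lambda lambdaD lambdaN {2 3}/lambda circA.
by rewrite invgM invgK /lambda -!mulgA mulVKg.
Qed.

Lemma lambda0 b : lambda 0 b = b.
Proof. by rewrite /lambda circ0b invg1 mul1g. Qed.

Lemma lambdaK a : cancel (lambda a) (lambda (circ_inv a)).
Proof. by move=> b; rewrite -lambda_circ circVb0 lambda0. Qed.

Lemma lambdaVK a : cancel (lambda (circ_inv a)) (lambda a).
Proof. by move=> b; rewrite -lambda_circ circbV0 lambda0. Qed.

Lemma lambdaV_sub x y : lambda (circ_inv x) (- x + y) = circ_inv x ∘ y.
Proof.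
by rewrite lambdaD lambdaN /lambda circVb0 mulg1 invgK mulVKg.
Qed.

Lemma lambda_subE x y : lambda x (circ_inv x ∘ y) = - x + y.
Proof. by rewrite -lambdaV_sub lambdaVK. Qed.

Lemma circ_conjE (a b : circ_group B) :
  (a ^ b)%g = (circ_inv b : B) ∘ (a ∘ b) :> B.
Proof. by []. Qed.

Lemma ker_lambdaE a b : ker_lambda B a -> a ∘ b = a + b.
Proof. by move=> ka; rewrite circE ka. Qed.

Lemma ker_lambda_inv a : ker_lambda B a -> circ_inv a = - a.
Proof.
by move=> ka; apply: (mulgI a); rewrite mulgV -ker_lambdaE // circbV0.
Qed.

Lemma ker_lambda0 : ker_lambda B 0.
Proof. by move=> b; rewrite lambda0. Qed.

Lemma ker_lambdaD a b :
  ker_lambda B a -> ker_lambda B b -> ker_lambda B (a + b).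
Proof. by move=> ka kb c; rewrite -ker_lambdaE // lambda_circ kb ka. Qed.

Lemma ker_lambdaN a : ker_lambda B a -> ker_lambda B (- a).
Proof. by move=> ka c; rewrite -ker_lambda_inv // -{1}(ka c) lambdaK. Qed.

Lemma ker_lambda_conj a b :
  ker_lambda B a -> ker_lambda B (b ∘ a ∘ circ_inv b).
Proof. by move=> ka c; rewrite !lambda_circ ka lambdaVK. Qed.

Lemma group_centre_subgroup (G : groupType) : subgroup (@group_centre G).
Proof.
split=> [x|x y cx cy z|x cx z]; first exact/commute_sym/commute1.
- by apply/commute_sym/commuteM; apply/commute_sym.
- exact/commute_sym/commuteV/commute_sym.
Qed.

Lemma group_centre_conj (G : groupType) (x y : G) :
  group_centre x -> (x ^ y)%g = x.
Proof. by move=> cx; rewrite /conjg cx mulKg. Qed.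

Lemma Soc_conj a b : Soc B a -> b ∘ a ∘ circ_inv b = lambda b a.
Proof.
move=> [ka ca]; rewrite -circA (ker_lambdaE _ ka) circDr circbV0 mulg1.
have cl : group_centre (lambda b a).
  move=> x; rewrite /commute -[x](lambdaVK b) -!lambdaD.
  by congr lambda; apply: ca.
by rewrite circE -mulgA (cl (- b)) mulVKg.
Qed.

Lemma Soc_lambda a b : Soc B a -> Soc B (lambda b a).
Proof.
move=> sa; split; first by rewrite -Soc_conj //; apply: ker_lambda_conj; case: sa.
move=> x; rewrite /commute -[x](lambdaVK b) -!lambdaD.
by congr lambda; apply: sa.2.
Qed.

Lemma Soc_subgroup : subgroup (Soc B).
Proof.
have [c0 cD cN] := group_centre_subgroup B.
split; first by split=> //; apply: ker_lambda0.
- by move=> x y [kx cx] [ky cy]; split; [apply: ker_lambdaD | apply: cD].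
- by move=> x [kx cx]; split; [apply: ker_lambdaN | apply: cN].
Qed.

(* Inside the kernel of lambda the two group laws agree. *)
Lemma ker_lambda_circ_subgroup (I : set B) :
  I `<=` ker_lambda B -> subgroup I -> @subgroup (circ_group B) I.
Proof.
move=> kI [I0 ID IN]; split; first by rewrite /= -circ_oneE in I0.
- by move=> x y Ix Iy; have := ID _ _ Ix Iy; rewrite -ker_lambdaE //; apply: kI.
- by move=> x Ix; have := IN _ Ix; rewrite -ker_lambda_inv //; apply: kI.
Qed.

Lemma Soc_ideal : ideal (Soc B).
Proof.
split; first split; first exact: Soc_subgroup.
- by move=> x y sx; rewrite group_centre_conj //; case: sx.
- by move=> b x; apply: Soc_lambda.
- split; first by apply: ker_lambda_circ_subgroup Soc_subgroup => x [].
  move=> x y sx; rewrite circ_conjE.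
  have := Soc_lambda (circ_inv y) sx.
  rewrite -Soc_conj // circA; congr (Soc B (_ ∘ _)).
  have /= := @invgK (circ_group B) y; exact.
Qed.

Lemma centre_ideal : ideal (centre B).
Proof.
have ss := Soc_subgroup.
have sc := group_centre_subgroup (circ_group B).
have sk : Soc B `<=` ker_lambda B by move=> x [].
have [s0 sD sN] := ss.
have [t0 tD tN] := sc.
have [c0 cD cN] := ker_lambda_circ_subgroup sk ss.
have sZ : subgroup (centre B).
  split=> [|x y [sx cx] [sy cy]|x [sx cx]].
  - by split=> //; rewrite -circ_oneE.
  - by split; [exact: sD | rewrite -ker_lambdaE; [exact: tD | exact: sk]].
  - by split; [exact: sN | rewrite -ker_lambda_inv; [exact: tN | exact: sk]].
split; first split=> //.
- by move=> x y zx; rewrite group_centre_conj //; case: zx => [[]].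
- move=> b x zx; suff -> : lambda b x = x by [].
  have [[kx cx] tx] := zx.
  have E : b ∘ x = x ∘ b by rewrite [RHS]tx.
  by rewrite /lambda E (ker_lambdaE _ kx) cx mulKg.
- split; first by apply: ker_lambda_circ_subgroup sZ => x [] /sk.
  by move=> x y zx; rewrite group_centre_conj //; case: zx.
Qed.

End BasicFacts.

Section Quotient.
Variables (B : skewBraceType) (I : set B) (idI : ideal I).
Implicit Types x y z : B.

Definition ideal_eq x y : bool := `[< I (- x + y) >].

Lemma ideal_eq_refl : reflexive ideal_eq.
Proof. by case: idI => [[[I0 _ _] _] _ _] x; apply/asboolP; rewrite mulVg. Qed.

Lemma ideal_eq_sym : symmetric ideal_eq.
Proof.
case: idI => [[[_ _ IN] _] _ _] x y.
by apply/asboolP/asboolP => /IN; rewrite invgM invgK.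
Qed.

Lemma ideal_eq_trans : transitive ideal_eq.
Proof.
case: idI => [[[_ ID _] _] _ _] y x z /asboolP Ixy /asboolP Iyz.
by apply/asboolP; have := ID _ _ Ixy Iyz; rewrite -mulgA mulVKg.
Qed.

Canonical ideal_eq_equiv :=
  EquivRel ideal_eq ideal_eq_refl ideal_eq_sym ideal_eq_trans.

(* The carrier of B/I; its elements are the additive cosets x + I, which are
   also the cosets x o I. *)
Definition quotient := {eq_quot ideal_eq_equiv}%qT.
HB.instance Definition _ := Choice.on quotient.

Definition quo (x : B) : quotient := (\pi_{eq_quot ideal_eq_equiv} x)%qT.

Definition quo_repr (u : quotient) : B := repr (u : {eq_quot ideal_eq_equiv}%qT).

Lemma quo_reprK : cancel quo_repr quo.
Proof. by move=> u; rewrite /quo /quo_repr reprK. Qed.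

Lemma quo_eq x y : quo x = quo y <-> I (- x + y).
Proof.
split; first by move=> /eqmodP /asboolP.
by move=> Ixy; apply/eqmodP/asboolP.
Qed.

Lemma quo_eq_circ x y : quo x = quo y <-> I (circ_inv x ∘ y).
Proof.
case: idI => _ Il _; rewrite quo_eq; split=> Ixy.
  by rewrite -lambdaV_sub; apply: Il.
by rewrite -lambda_subE; apply: Il.
Qed.

Let qadd (u v : quotient) : quotient := quo (quo_repr u + quo_repr v).
Let qopp (u : quotient) : quotient := quo (- quo_repr u).
Let qcirc (u v : quotient) : quotient := quo (quo_repr u ∘ quo_repr v).
Let qcinv (u : quotient) : quotient := quo (circ_inv (quo_repr u)).

Lemma normal_subgroup_mul_compat (G : groupType) (N : set G) (x y x' y' : G) :
  normal_subgroup N -> N (x^-1 * x')%g -> N (y^-1 * y')%g ->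
  N ((x * y)^-1 * (x' * y'))%g.
Proof.
move=> [[_ ND _] NJ] Nx Ny; have := ND _ _ (NJ _ y Nx) Ny.
by rewrite /conjg invgM -!mulgA mulVKg.
Qed.

Lemma normal_subgroup_inv_compat (G : groupType) (N : set G) (x x' : G) :
  normal_subgroup N -> N (x^-1 * x')%g -> N (x^-1^-1 * x'^-1)%g.
Proof.
move=> [[_ _ NN] NJ] Nx; have := NJ _ x^-1%g (NN _ Nx).
by rewrite /conjg invgM !invgK -!mulgA mulgV mulg1.
Qed.

Lemma quoD x y : quo (x + y) = qadd (quo x) (quo y).
Proof.
case: idI => nI _ _; apply/quo_eq; apply: normal_subgroup_mul_compat => //;
by apply/quo_eq; rewrite quo_reprK.
Qed.

Lemma quoN x : quo (- x) = qopp (quo x).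
Proof.
case: idI => nI _ _; apply/quo_eq; apply: normal_subgroup_inv_compat => //;
by apply/quo_eq; rewrite quo_reprK.
Qed.

Lemma quo_circ x y : quo (x ∘ y) = qcirc (quo x) (quo y).
Proof.
case: idI => _ _ nI; apply/quo_eq_circ.
apply: (@normal_subgroup_mul_compat (circ_group B)) => //;
by apply/quo_eq_circ; rewrite quo_reprK.
Qed.

Lemma quo_circ_inv x : quo (circ_inv x) = qcinv (quo x).
Proof.
case: idI => _ _ nI; apply/quo_eq_circ.
apply: (@normal_subgroup_inv_compat (circ_group B)) => //;
by apply/quo_eq_circ; rewrite quo_reprK.
Qed.

Lemma quoP (P : quotient -> Prop) : (forall x, P (quo x)) -> forall u, P u.
Proof. by move=> Pq u; rewrite -(quo_reprK u). Qed.

Let qaddA : associative qadd.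
Proof.
elim/quoP=> x; elim/quoP=> y; elim/quoP=> z.
by rewrite -!quoD mulgA.
Qed.
Let qadd0l : left_id (quo 0) qadd.
Proof. by elim/quoP=> x; rewrite -quoD mul1g. Qed.
Let qadd0r : right_id (quo 0) qadd.
Proof. by elim/quoP=> x; rewrite -quoD mulg1. Qed.
Let qaddNl : left_inverse (quo 0) qopp qadd.
Proof. by elim/quoP=> x; rewrite -quoN -quoD mulVg. Qed.
Let qaddNr : right_inverse (quo 0) qopp qadd.
Proof. by elim/quoP=> x; rewrite -quoN -quoD mulgV. Qed.

HB.instance Definition _ :=
  isGroup.Build quotient qaddA qadd0l qadd0r qaddNl qaddNr.

Let qcircA : associative qcirc.
Proof.
elim/quoP=> x; elim/quoP=> y; elim/quoP=> z.
by rewrite -!quo_circ circA.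
Qed.
Let qcirc0l : left_id (quo circ_one) qcirc.
Proof. by elim/quoP=> x; rewrite -quo_circ circ1b. Qed.
Let qcirc0r : right_id (quo circ_one) qcirc.
Proof. by elim/quoP=> x; rewrite -quo_circ circb1. Qed.
Let qcircVl : left_inverse (quo circ_one) qcinv qcirc.
Proof. by elim/quoP=> x; rewrite -quo_circ_inv -quo_circ circVb. Qed.
Let qcircVr : right_inverse (quo circ_one) qcinv qcirc.
Proof. by elim/quoP=> x; rewrite -quo_circ_inv -quo_circ circbV. Qed.
Let qcircDr (u v w : quotient) :
  qcirc u (v + w) = qcirc u v - u + qcirc u w.
Proof.
elim/quoP: u => x; elim/quoP: v => y; elim/quoP: w => z.
change (qcirc (quo x) (qadd (quo y) (quo z)) =
  qadd (qadd (qcirc (quo x) (quo y)) (qopp (quo x))) (qcirc (quo x) (quo z))).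
by rewrite -(quoD y z) -quoN -!quo_circ -!quoD circDr.
Qed.

HB.instance Definition _ := isSkewBrace.Build quotient
  qcircA qcirc0l qcirc0r qcircVl qcircVr qcircDr.

Lemma quo_hom : skew_brace_hom quo.
Proof. by split; [exact: quoD | exact: quo_circ]. Qed.

End Quotient.

Definition Soc2 (B : skewBraceType) : set B :=
  quo (Soc_ideal B) @^-1` Soc (quotient (Soc_ideal B)).

Definition centre2 (B : skewBraceType) : set B :=
  quo (centre_ideal B) @^-1` centre (quotient (centre_ideal B)).

Section Product.
Variables S T : skewBraceType.

Let pcirc (u v : S * T) : S * T := (u.1 ∘ v.1, u.2 ∘ v.2).
Let pone : S * T := (circ_one, circ_one).
Let pinv (u : S * T) : S * T := (circ_inv u.1, circ_inv u.2).

Let pcircA : associative pcirc.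
Proof. by move=> u v w; rewrite /pcirc !circA. Qed.
Let pcirc1b : left_id pone pcirc.
Proof. by case=> u v; rewrite /pcirc !circ1b. Qed.
Let pcircb1 : right_id pone pcirc.
Proof. by case=> u v; rewrite /pcirc !circb1. Qed.
Let pcircVb : left_inverse pone pinv pcirc.
Proof. by move=> u; rewrite /pcirc !circVb. Qed.
Let pcircbV : right_inverse pone pinv pcirc.
Proof. by move=> u; rewrite /pcirc !circbV. Qed.
Let pcircDr (u v w : S * T) : pcirc u (v + w) = pcirc u v - u + pcirc u w.
Proof. by rewrite /pcirc !circDr. Qed.

HB.instance Definition _ := isSkewBrace.Build (S * T)%type
  pcircA pcirc1b pcircb1 pcircVb pcircbV pcircDr.

End Product.

Arguments Soc2 : clear implicits.
Arguments centre2 : clear implicits.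

(* Main.v *)
Require Import Defs.
From HB Require Import structures.
From mathcomp Require Import all_boot.
From mathcomp Require Import order ssralg ssrnum ssrint intdiv.
From mathcomp Require Import zify.
From mathcomp Require Import boolp classical_sets cardinality.

Set Implicit Arguments.
Unset Strict Implicit.
Unset Printing Implicit Defensive.

Local Open Scope classical_set_scope.
Local Open Scope skew_scope.

(** Write S for the socle. That the second socle is everything means that B/S
    is trivial with abelian additive group, so that every star product
    [star a b = lambda a b - b] and every additive commutator lies in S, which
    is central in (B,+). Hence lambda is also a homomorphism from (B,+)
    ([lambdaDl]), and an additive subgroup stable under its own lambda maps is
    a sub-skew brace. Two families of sub-skew braces are then ideals, B being
    Dedekind: all subgroups of S, and, for each b, the group [gen_brace b] of
    all n b + k (b * b).

    The socle is not periodic ([Soc_not_periodic]). Otherwise b of infinite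
    additive order has a multiple g, fixed by [lambda b], that spans an ideal
    meeting S trivially; star products and commutators of g lie in that
    intersection, so g is in S, which is absurd.

    Each [lambda b] preserves all subgroups of the non-periodic abelian group
    S, so it is 1 or -1 there ([power_automorphism]). The value -1 is excluded
    in [lambda_Soc]: for x in S the ideal [gen_brace b] contains
    [star b x = - 2 x], which forces 4 x to be a multiple of b * b. This also
    holds after b is replaced by b + y with y in S, which turns s = b * b into
    s - 2 y; for y = 3 s it says that 4 s is a multiple of 5 s, whereas s has
    infinite order. So lambda fixes S pointwise, and S is the centre.

    Now the star product is biadditive and vanishes on S on either side. For f
    one of the maps [star c], [fun a => star a c] and [fun a => [~ a, c]], the
    value f(a) lies in the ideal [gen_brace (a + y)] for all y in S. Choosing y
    so that a + y has infinite order shows that f(a) is a multiple of a * a,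
    which is a torsion element ([multiples_star_diag]). In particular a * b is
    a multiple of both a * a and b * b. If a * b = k (b * b), then the element
    d = a + (1 - k) b has both a * a and b * b among the multiples of d * d
    ([star_diag_directed]). So B * B is the directed union of the finite cyclic
    groups generated by the d * d: it is periodic and locally cyclic.

    Finally B/S is periodic, because m a is in S when m (a * a) = 0. The
    torsion elements form an ideal J, since commutators are torsion and
    central, and B/J is trivial and torsion-free. A maximal torsion-free
    subgroup I of S ([torsion_complement]) is an ideal with B/I periodic, and I
    meets J trivially, so B embeds into B/J x B/I. *)

(** * Integer multiples, torsion and locally cyclic groups *)

(** Coefficients are integers because all the equations below compare multiples
   with possibly negative coefficients; the group need not be abelian. *)
Definition zmul (G : groupType) (x : G) (k : int) : G :=
  match k with Posz n => (x ^+ n)%g | Negz n => (x ^- n.+1)%g end.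
Arguments zmul {G} x k%_R.
Notation "x *~ k" := (zmul x k) : skew_scope.

Definition multiples (G : groupType) (x : G) : set G := range (zmul x).
Arguments multiples {G} x.

Definition torsion (G : groupType) (x : G) :=
  exists2 n, (0 < n)%N & (x ^+ n)%g = 0.
Arguments torsion {G} x.

Section IntegerMultiples.
Context {G : groupType}.
Implicit Types (x y : G) (k l : int) (H : set G).

Lemma zmul0 x : x *~ 0 = 0. Proof. by []. Qed.

Lemma zmul1 x : x *~ 1 = x. Proof. by []. Qed.

Lemma zmulNr x k : x *~ (- k) = - (x *~ k).
Proof. by case: k => [[|n]|n] //=; rewrite ?invg1 ?invgK. Qed.

Lemma zmul_subn x (m n : nat) : x *~ (m%:Z - n%:Z) = (x ^+ m)%g - (x ^+ n)%g.
Proof.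
case: (leqP n m) => [le_nm|/ltnW le_mn].
  by rewrite subzn //= expgnFr.
rewrite -GRing.opprB subzn // zmulNr /= expgnFr //.
by rewrite invgM invgK.
Qed.

Lemma zmulDr x k l : x *~ (k + l) = x *~ k + x *~ l.
Proof.
have E j : exists m n : nat, j = (m%:Z - n%:Z)%R.
  by case: j => n; [exists n, 0%N | exists 0%N, n.+1]; lia.
have [m [n ->]] := E k; have [p [q ->]] := E l.
have -> : (m%:Z - n%:Z + (p%:Z - q%:Z) = (m + p)%N%:Z - (q + n)%N%:Z)%R by lia.
rewrite !zmul_subn !expgnDr invgM !mulgA; congr (_ * _)%g; rewrite -!mulgA.
by congr (_ * _)%g; apply: commuteV; apply: commuteX2.
Qed.

Lemma zmulMr x k l : x *~ (k * l) = (x *~ k) *~ l.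
Proof.
have E (n : nat) : x *~ (k * n) = (x *~ k) *~ n.
  elim: n => [|n IHn]; first by rewrite GRing.mulr0.
  have -> : (k * n.+1 = k + k * n)%R by lia.
  by rewrite zmulDr IHn /= expgS.
case: l => n; first exact: E.
have -> : Negz n = (- (n.+1%:Z))%R by [].
by rewrite GRing.mulrN !zmulNr E.
Qed.

Lemma zmulNl x k : (- x) *~ k = - (x *~ k).
Proof. by rewrite -[- x]/(x *~ (-1)) -zmulMr GRing.mulN1r zmulNr. Qed.

Lemma commute_zmul x y k : commute x y -> commute x (y *~ k).
Proof.
by move=> cxy; case: k => n /=; [|apply: commuteV]; apply: commuteX.
Qed.

Lemma zmulDl x y k : commute x y -> (x + y) *~ k = x *~ k + y *~ k.
Proof.
move=> cxy; case: k => n /=; first exact: expgMn.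
rewrite expgMn // invgM; apply: commuteV; apply: commute_sym; apply: commuteV.
exact: commuteX2.
Qed.

Lemma zmul0l k : 0 *~ k = 0 :> G.
Proof. by case: k => n /=; rewrite expg1n ?invg1. Qed.

Lemma subgroup_zmul H x k : subgroup H -> H x -> H (x *~ k).
Proof.
case=> H0 HD HN Hx.
have E n : H (x ^+ n)%g by elim: n => // n IHn; rewrite expgS; apply: HD.
by case: k => n /=; [|apply: HN]; apply: E.
Qed.

Lemma torsionP x : torsion x <-> exists2 k, k <> 0%R & x *~ k = 0.
Proof.
split=> [[n n0 xn]|[[n|n] k0 xk]]; first by exists (Posz n) => //; lia.
- by exists n => //; lia.
- by exists n.+1 => //; rewrite -[LHS]invgK -[RHS]invg1; congr inv.
Qed.

Lemma torsion0 : torsion (0 : G). Proof. by exists 1%N. Qed.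

Lemma torsionN x : torsion x -> torsion (- x).
Proof. by case=> n n0 xn; exists n; rewrite // expVgn xn invg1. Qed.

Lemma torsion_zmul x k : torsion x -> torsion (x *~ k).
Proof.
move=> /torsionP[l l0 xl]; apply/torsionP; exists l => //.
by rewrite -zmulMr GRing.mulrC zmulMr xl zmul0l.
Qed.

Lemma zmul_torsion x k : torsion (x *~ k) -> k <> 0%R -> torsion x.
Proof.
move=> /torsionP[l l0 xl] k0; apply/torsionP; exists (k * l)%R; first by nia.
by rewrite zmulMr.
Qed.

Lemma torsionD x y : commute x y -> torsion x -> torsion y -> torsion (x + y).
Proof.
move=> cxy /torsionP[k k0 xk] /torsionP[l l0 yl]; apply/torsionP.
exists (k * l)%R; first by nia.
by rewrite zmulDl // zmulMr xk {1}GRing.mulrC zmulMr yl !zmul0l mulg1.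
Qed.

Lemma zmul_inj x k l : ~ torsion x -> x *~ k = x *~ l -> k = l.
Proof.
move=> tx E; apply/eqP; apply: contrapT => /eqP nkl; apply: tx.
apply/torsionP; exists (k - l)%R; first by lia.
by rewrite zmulDr zmulNr E mulgV.
Qed.

Lemma multiples_id x : multiples x x. Proof. by exists 1%R. Qed.

Lemma multiples_subgroup x : subgroup (multiples x).
Proof.
split; first by exists 0%R.
- by move=> _ _ [k _ <-] [l _ <-]; exists (k + l)%R; rewrite // zmulDr.
- by move=> _ [k _ <-]; exists (- k)%R; rewrite // zmulNr.
Qed.

Lemma multiples_sub H x : subgroup H -> H x -> multiples x `<=` H.
Proof. by move=> sH Hx _ [k _ <-]; apply: subgroup_zmul. Qed.

Lemma generated_subgroup (A : set G) : subgroup (generated A).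
Proof.
split=> [H [[]] //|x y gx gy H sHA|x gx H sHA]; have [[_ HD HN] _] := sHA.
- by apply: HD; [apply: gx | apply: gy].
- by apply: HN; apply: gx.
Qed.

Lemma generated_incl (A : set G) : A `<=` generated A.
Proof. by move=> x Ax H [_]; apply. Qed.

Lemma generated_min (A H : set G) :
  subgroup H -> A `<=` H -> generated A `<=` H.
Proof. by move=> sH AH x; apply. Qed.

Lemma generated1 x : generated [set x] = multiples x.
Proof.
apply/seteqP; split.
  apply: generated_min; first exact: multiples_subgroup.
  by move=> _ ->; apply: multiples_id.
by apply: multiples_sub; [apply: generated_subgroup | apply: generated_incl].
Qed.

(** Euclidean division by the least positive exponent occurring in the subgroup;
   without such an exponent the subgroup is zero. *)
Lemma subgroup_of_cyclic H x :
  subgroup H -> H `<=` multiples x -> cyclic_subgroup H.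
Proof.
move=> sH Hx; have [_ HD HN] := sH.
have [[n0 n0gt Hn0]|noH] := pselect (exists2 n, (0 < n)%N & H (x ^+ n)%g);
  last first.
  exists 0; rewrite generated1; apply/seteqP; split; last first.
    by apply: multiples_sub => //; case: sH.
  move=> y Hy; have [[[|n]|n] _ xy] := Hx _ Hy; move: Hy; rewrite -xy /=.
  - by exists 0%R.
  - by move=> Hy; case: noH; exists n.+1.
  - by move=> /HN; rewrite invgK => Hy; case: noH; exists n.+1.
have exP : exists n, (0 < n)%N && `[< H (x ^+ n)%g >].
  by exists n0; rewrite n0gt; apply/asboolP.
case: (ex_minnP exP) => n /andP[ngt /asboolP Hn] nmin.
exists (x ^+ n)%g; rewrite generated1; apply/seteqP; split; last first.
  exact: multiples_sub.
move=> y Hy; have [k _ xk] := Hx _ Hy.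
have nz : (n%:Z <> 0)%R by lia.
have Ek := divz_eq k n.
have r0 : (0 <= (k %% n)%Z)%R by apply: modz_ge0; lia.
have rn : ((k %% n)%Z < n)%R by apply: ltz_pmod.
have Er : x *~ (k %% n)%Z = y - x *~ ((k %/ n)%Z * n).
  by rewrite -xk -zmulNr -zmulDr {2}Ek GRing.addrAC GRing.subrr GRing.add0r.
have Hr : H (x *~ (k %% n)%Z).
  rewrite Er; apply: HD => //; apply: HN; rewrite GRing.mulrC zmulMr.
  exact: subgroup_zmul.
exists (k %/ n)%Z => //; change (x ^+ n)%g with (x *~ n); rewrite -zmulMr.
case: {2}(k %% n)%Z (erefl (k %% n)%Z) => [[|r]|r] Ekn;
  move: Er Hr; rewrite Ekn.
- by move=> /esym/divg1_eq ->; rewrite GRing.mulrC.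
- move=> _ Hr; have := nmin r.+1; rewrite /=.
  have -> : `[< H (x ^+ r.+1)%g >] by apply/asboolP.
  by move=> /(_ isT); lia.
- by lia.
Qed.

(** Induction on the finite set puts it inside a single cyclic subgroup, and
   subgroups of cyclic groups are cyclic. *)
Lemma locally_cyclic_directed H :
    H 0 -> (forall x y, H x -> H y ->
    exists2 z, H z & multiples z x /\ multiples z y) ->
  locally_cyclic H.
Proof.
move=> H0 dirH A finA AH.
suff [z _ Az] : exists2 z, H z & A `<=` multiples z.
  apply: (@subgroup_of_cyclic _ z); first exact: generated_subgroup.
  by apply: generated_min => //; apply: multiples_subgroup.
have [s As] := (finite_seqP A).1 finA; move: AH; rewrite {A finA}As.
elim: s => [|x s IHs] AH; first by exists 0.
have [|z Hz sz] := IHs.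
  by move=> y /= ys; apply: AH; rewrite /= inE ys orbT.
have [||w Hw [wx wz]] := dirH x z => //.
  by apply: AH; rewrite /= inE eqxx.
exists w => // y /=; rewrite inE => /orP[/eqP -> //|ys].
exact: (multiples_sub (multiples_subgroup w) wz (sz _ ys)).
Qed.

End IntegerMultiples.

(** Such an I is a maximal torsion-free subgroup. If no nonzero multiple of y
   were in I, then I and y would generate a larger one: when q (i + n y) = 0,
   the element n q y is in I, hence n = 0 and i is a torsion element of I. *)
Lemma torsion_complement (G : groupType) (A : set G) :
    subgroup A -> (forall x y, A x -> A y -> commute x y) ->
  exists I : set G, [/\ subgroup I, I `<=` A,
    forall x, I x -> torsion x -> x = 0 &
    forall y, A y -> exists2 n : int, n <> 0%R & I (y *~ n)].
Proof.
move=> sA cA; have [A0 AD AN] := sA.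
(* Zorn's lemma is applied to sets closed under subtraction rather than to
   subgroups, so that the union of the empty chain qualifies. *)
pose P (X : set G) := [/\ X `<=` A, forall x y, X x -> X y -> X (x - y) &
  forall x, X x -> torsion x -> x = 0].
have [|I [[IA IB It] Imax]] := @Zorn_bigcup G P.
  move=> F FP Ftot; split.
  - by move=> x [X FX Xx]; have [XA _ _] := FP _ FX; apply: XA.
  - move=> x y [X FX Xx] [Y FY Yy].
    have [XY|YX] := Ftot _ _ FX FY.
      by exists Y => //; have [_ YB _] := FP _ FY; apply: YB => //; apply: XY.
    by exists X => //; have [_ XB _] := FP _ FX; apply: XB => //; apply: YX.
  - by move=> x [X FX Xx]; have [_ _ Xt] := FP _ FX; apply: Xt.
have I0 : I 0.
  have [[x Ix]|nI] := pselect (exists x, I x).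
    by rewrite -(mulgV x); apply: IB.
  exfalso; apply: (Imax [set 0]).
    split=> [x Ix|]; first by case: nI; exists x.
    by move=> /(_ 0 erefl) Ix; case: nI; exists 0.
  by split=> [_ ->|_ _ -> ->|_ ->] //=; rewrite invg1 mulg1.
have sI : subgroup I.
  have IN x : I x -> I (- x) by move=> Ix; rewrite -(mul1g (- x)); apply: IB.
  split=> // x y Ix Iy; rewrite -(invgK y); apply: IB => //; exact: IN.
exists I; split=> // y Ay; apply: contrapT => ny.
have yI n : I (y *~ n) -> n = 0%R.
  by move=> Iyn; apply: contrapT => n0; apply: ny; exists n.
pose J := [set x | exists2 i, I i & exists n, x = i + y *~ n].
have cI i n : I i -> commute i (y *~ n).
  by move=> Ii; apply: commute_zmul; apply: cA => //; apply: IA.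
apply: (Imax J).
  split=> [i Ii|JI]; first by exists i => //; exists 0%R; rewrite mulg1.
  suff /yI : I (y *~ 1) by [].
  by apply: JI; exists 0 => //; exists 1%R; rewrite mul1g.
split.
- move=> _ [i Ii [n ->]]; apply: AD; first exact: IA.
  exact: subgroup_zmul.
- move=> _ _ [i Ii [n ->]] [j Ij [m ->]]; exists (i - j); first exact: IB.
  exists (n - m)%R; have [_ _ IN] := sI.
  rewrite invgM zmulDr zmulNr -!mulgA; congr (_ * _)%g.
  rewrite mulgA -zmulNr -zmulDr; apply/esym/cI; exact: IN.
- move=> _ [i Ii [n ->]] /torsionP[q q0].
  rewrite zmulDl; last exact: cI.
  rewrite -zmulMr => E.
  have nq : (n * q = 0)%R.
    apply: yI; have -> : y *~ (n * q) = - (i *~ q).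
      by apply: (mulgI (i *~ q)); rewrite E mulgV.
    by have [_ _ IN] := sI; apply: IN; apply: subgroup_zmul.
  have n0 : n = 0%R by nia.
  rewrite n0 mulg1; apply: It => //; apply/torsionP; exists q => //.
  by move: E; rewrite nq mulg1.
Qed.

Section GroupMorphisms.
Context {G H : groupType} {f : G -> H}.
Hypothesis fD : {morph f : x y / x + y}.

Lemma morph0 : f 0 = 0.
Proof. by apply: (mulgI (f 0)); rewrite -fD !mulg1. Qed.

Lemma morphN x : f (- x) = - f x.
Proof. by apply: (mulgI (f x)); rewrite -fD !mulgV morph0. Qed.

Lemma morph_zmul x k : f (x *~ k) = f x *~ k.
Proof.
have E n : f (x ^+ n)%g = (f x ^+ n)%g.
  by elim: n => [|n IHn]; rewrite ?morph0 // !expgS fD IHn.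
by case: k => n /=; rewrite ?morphN E.
Qed.

Lemma preimage_subgroup (K : set H) : subgroup K -> subgroup (f @^-1` K).
Proof.
case=> K0 KD KN; split=> [|x y Kx Ky|x Kx] /=; rewrite /preimage /= ?morph0 //.
- by rewrite fD; apply: KD.
- by rewrite morphN; apply: KN.
Qed.

Lemma morph_multiples x y : multiples x y -> multiples (f x) (f y).
Proof. by case=> k _ <-; exists k; rewrite ?morph_zmul. Qed.

End GroupMorphisms.

(** * Ideals and quotients of skew braces *)

Section Ideals.
Context {B : skewBraceType}.
Implicit Types (a b x y : B) (I : set B) (k : int).

Lemma lambdaE a b : lambda a b = star a b + b.
Proof. by rewrite /star mulgVK. Qed.

Lemma ideal_subgroup I : ideal I -> subgroup I.
Proof. by case=> [[]]. Qed.

Lemma ideal_star_r I a x : ideal I -> I x -> I (star a x).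
Proof.
move=> [[[_ ID IN] _] Il _] Ix; apply: ID; last exact: IN.
exact: Il.
Qed.

(** With y the circle conjugate of x by a, the equality x ∘ a = a ∘ y shows that
   [star x a] is - x plus the additive conjugate of [lambda a y] by - a. *)
Lemma ideal_star_l I a x : ideal I -> I x -> I (star x a).
Proof.
move=> [[[_ ID IN] IJ] Il [_ IC]] Ix.
pose y := circ_inv a ∘ (x ∘ a).
have Iy : I y by apply: (IC x a).
have E : a + lambda a y = x ∘ a by rewrite -circE /y circA circbV0 circ0b.
rewrite /star -E -mulgA; apply: ID; first exact: IN.
have := IJ _ (- a) (Il a _ Iy).
by rewrite /conjg invgK mulgA.
Qed.

Lemma ideal_commg I a x : ideal I -> I x -> I [~ x, a]%g.
Proof.
by move=> [[[_ ID IN] IJ] _ _] Ix; apply: ID; [apply: IN | apply: IJ].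
Qed.

Lemma Soc_commute x b : Soc B x -> commute x b.
Proof. by case=> _; apply. Qed.

Lemma Soc_lambdaE x b : Soc B x -> lambda x b = b.
Proof. by case=> kx _; apply: kx. Qed.

Lemma Soc_zmul x k : Soc B x -> Soc B (x *~ k).
Proof. by move=> Sx; apply: subgroup_zmul => //; apply: Soc_subgroup. Qed.

(** Circle products and inverses are u ∘ v = u + lambda u v and circ_inv u =
   lambda (circ_inv u) (- u). *)
Lemma sub_skew_brace_lambda (A : set B) :
  subgroup A -> (forall u v, A u -> A v -> A (lambda u v)) ->
  (forall u v, A u -> A v -> A (lambda (circ_inv u) v)) -> sub_skew_brace A.
Proof.
move=> sA Al AVl; have [A0 AD AN] := sA; split=> //; split.
- by move: A0; rewrite -circ_oneE.
- by move=> u v Au Av; rewrite [X in A X]circE; apply: AD => //; apply: Al.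
- move=> u Au; have := lambdaV_sub (u : B) 0; rewrite mulg1 circb0 => E.
  by change (A (circ_inv (u : B))); rewrite -E; apply: AVl => //; apply: AN.
Qed.

Lemma star_sub_star a b : star_sub B (star a b).
Proof. by apply: generated_incl; exists (a, b). Qed.

Lemma star_sub_subgroup : subgroup (star_sub B).
Proof. exact: generated_subgroup. Qed.

End Ideals.

Section QuotientFacts.
Context {B : skewBraceType} {I : set B} (idI : ideal I).
Implicit Types a b x y : B.

Let quoD : {morph quo idI : x y / x + y} := (quo_hom idI).1.

Lemma quo_eq0 x : quo idI x = 0 <-> I x.
Proof.
have [_ _ IN] := ideal_subgroup idI.
rewrite -(morph0 quoD); split=> [/quo_eq|Ix].
  by rewrite mulg1 => /IN; rewrite invgK.
by apply/quo_eq; rewrite mulg1; apply: IN.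
Qed.

Lemma quo_zmul x k : quo idI (x *~ k) = quo idI x *~ k.
Proof. exact: (morph_zmul quoD). Qed.

Lemma quo_star a b : quo idI (star a b) = star (quo idI a) (quo idI b).
Proof. by rewrite /star !quoD !(morphN quoD) (quo_hom idI).2. Qed.

Lemma quo_trivial :
  (forall a b, I (star a b)) -> trivial_skew_brace (quotient idI).
Proof.
move=> Is; elim/quoP=> a; elim/quoP=> b.
have E : lambda (quo idI a) (quo idI b) = quo idI b.
  rewrite lambdaE -quo_star (_ : quo idI (star a b) = 0) ?mul1g //.
  exact/quo_eq0.
by rewrite circE E.
Qed.

Lemma star_sub_quo x : star_sub B x -> star_sub (quotient idI) (quo idI x).
Proof.
move: x; apply: (@generated_min _ _ (quo idI @^-1` star_sub (quotient idI))).
  by apply: (preimage_subgroup quoD); apply: generated_subgroup.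
move=> _ [[a b] _ <-]; apply: generated_incl.
by exists (quo idI a, quo idI b) => //=; rewrite quo_star.
Qed.

Lemma star_sub_quo_lift u :
  star_sub (quotient idI) u -> exists2 x, star_sub B x & u = quo idI x.
Proof.
have [S0 SD SN] := generated_subgroup [set star p.1 p.2 | p in [set: B * B]].
move: u; apply: (@generated_min _ _
  [set u | exists2 x, star_sub B x & u = quo idI x]).
  split; first by exists 0 => //; rewrite (morph0 quoD).
  - move=> _ _ [x Sx ->] [y Sy ->]; exists (x + y); first exact: SD.
    by rewrite quoD.
  - by move=> _ [x Sx ->]; exists (- x); [apply: SN | rewrite (morphN quoD)].
move=> _ [[u v] _ <-] /=; elim/quoP: u => a; elim/quoP: v => b.
by exists (star a b); [apply: generated_incl; exists (a, b) | rewrite quo_star].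
Qed.

End QuotientFacts.

(** * Sub-skew braces generated by one element *)

Section SecondSocle.
Context {B : skewBraceType}.
Hypothesis hD : dedekind B.
Hypothesis hS : Soc2 B = [set: B].
Implicit Types (a b g u x y : B) (A I : set B).

Lemma Soc2_quo a : Soc (quotient (Soc_ideal B)) (quo (Soc_ideal B) a).
Proof. by have : Soc2 B a by rewrite hS. Qed.

Lemma star_Soc a b : Soc B (star a b).
Proof.
have [qD qC] := quo_hom (Soc_ideal B); have [+ _] := Soc2_quo a.
move/(_ (quo (Soc_ideal B) b)); rewrite /lambda -qC -(morphN qD) -qD => E.
have : quo (Soc_ideal B) 0 = quo (Soc_ideal B) (star a b).
  by rewrite /star qD E (morphN qD) mulgV (morph0 qD).
by move/quo_eq; rewrite invg1 mul1g.
Qed.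

Lemma commg_Soc a b : Soc B [~ a, b]%g.
Proof.
have [qD qC] := quo_hom (Soc_ideal B); have [_ /(_ (quo _ b)) E] := Soc2_quo a.
have /quo_eq : quo (Soc_ideal B) (b + a) = quo (Soc_ideal B) (a + b).
  by rewrite !qD E.
by rewrite /commg /conjg invgM -mulgA.
Qed.

(** a ∘ b = star a b + (a + b) = star a b ∘ (a + b), and the socle element [star
   a b] acts trivially. *)
Lemma lambdaDl a b c : lambda (a + b) c = lambda a (lambda b c).
Proof.
have Es := star_Soc a b.
have E : a ∘ b = star a b ∘ (a + b).
  rewrite (ker_lambdaE _ Es.1) (circE a b) lambdaE (mulgA a).
  by rewrite -(Soc_commute a Es) -(mulgA (star a b)).
by rewrite -lambda_circ E lambda_circ (Soc_lambdaE _ Es).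
Qed.

Lemma lambdaNl a b : lambda (circ_inv a) b = lambda (- a) b.
Proof.
by rewrite -[b in RHS](lambdaVK a) -lambdaDl mulVg lambda0.
Qed.

Lemma sub_skew_brace_of_lambda A :
  subgroup A -> (forall u v, A u -> A v -> A (lambda u v)) -> sub_skew_brace A.
Proof.
move=> sA Al; have [_ _ AN] := sA; apply: sub_skew_brace_lambda => // u v Au Av.
by rewrite lambdaNl; apply: Al => //; apply: AN.
Qed.

Lemma sub_skew_brace_Soc A : subgroup A -> A `<=` Soc B -> sub_skew_brace A.
Proof.
move=> sA AS; apply: sub_skew_brace_of_lambda => // u v Au Av.
by rewrite Soc_lambdaE //; apply: AS.
Qed.

(** The cyclic subgroup generated by x is an ideal. *)
Lemma lambda_multiples b x : Soc B x -> multiples x (lambda b x).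
Proof.
move=> Sx; have : sub_skew_brace (multiples x).
  apply: sub_skew_brace_Soc; first exact: multiples_subgroup.
  by apply: multiples_sub => //; apply: Soc_subgroup.
by move=> /hD[_ /(_ b x) + _]; apply; apply: multiples_id.
Qed.

(** The sub-skew brace generated by b when B is Dedekind and its star products
   lie in the socle. *)
Definition gen_brace b : set B :=
  [set u | exists n k : int, u = b *~ n + star b b *~ k].

Lemma gen_brace_subgroup b : subgroup (gen_brace b).
Proof.
have C c k : commute (star b b *~ k) c.
  by apply/commute_sym/commute_zmul/commute_sym/Soc_commute/star_Soc.
split; first by exists 0%R, 0%R; rewrite mulg1.
- move=> _ _ [n [k ->]] [m [l ->]]; exists (n + m)%R, (k + l)%R.
  rewrite !zmulDr !mulgA; congr (_ * _)%g; rewrite -!mulgA; congr (_ * _)%g.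
  exact: C.
- move=> _ [n [k ->]]; exists (- n)%R, (- k)%R.
  by rewrite !zmulNr invgM -!zmulNr C.
Qed.

Lemma gen_brace_id b : gen_brace b b.
Proof. by exists 1%R, 0%R; rewrite mulg1. Qed.

Lemma gen_brace_star b : gen_brace b (star b b).
Proof. by exists 0%R, 1%R; rewrite mul1g. Qed.

Lemma gen_brace_min b (H : set B) :
  subgroup H -> H b -> H (star b b) -> gen_brace b `<=` H.
Proof.
move=> sH Hb Hs _ [n [k ->]]; case: (sH) => _ HD _.
by apply: HD; apply: subgroup_zmul.
Qed.

(** By [lambdaDl] the elements u for which [lambda u] and [lambda (- u)]
   preserve the set form a subgroup, so only u = b and u = star b b matter. The
   latter acts trivially; [lambda b] sends b to star b b + b and sends star b b
   to a multiple of itself. *)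
Lemma gen_brace_ideal b : ideal (gen_brace b).
Proof.
apply: hD; set C := gen_brace b; set s := star b b.
have sC := gen_brace_subgroup b; have [C0 CD CN] := sC.
have Cb : C b by apply: gen_brace_id.
have Cs : C s by apply: gen_brace_star.
have Cls c : C (lambda c s).
  by apply: (multiples_sub sC Cs); apply: lambda_multiples; apply: star_Soc.
have stable c : C (lambda c b) -> forall u, C u -> C (lambda c u).
  move=> Ccb; apply: gen_brace_min => //.
  exact: (preimage_subgroup (lambdaD c)).
have stb : forall u, C u -> C (lambda b u).
  by apply: stable; rewrite lambdaE; apply: CD.
have stNb : forall u, C u -> C (lambda (- b) u).
  apply: stable; have : lambda (- b) (lambda b b) = b.
    by rewrite -lambdaDl mulVg lambda0.
  rewrite (lambdaE b b) lambdaD -/s => E.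
  have -> : lambda (- b) b = - lambda (- b) s + b.
    by apply: (mulgI (lambda (- b) s)); rewrite mulVKg.
  by apply: CD => //; apply: CN; apply: Cls.
pose L := [set u | forall v, C v -> C (lambda u v) /\ C (lambda (- u) v)].
have sL : subgroup L.
  split=> [v Cv|u v Lu Lv w Cw|u Lu v Cv]; first by rewrite invg1 lambda0.
  - rewrite invgM !lambdaDl; have [C1 C2] := Lu _ Cw; have [C3 C4] := Lv _ Cw.
    by split; [have [] := Lu _ C3 | have [] := Lv _ C2].
  - by rewrite invgK; case: (Lu v Cv).
have CL : C `<=` L.
  apply: gen_brace_min => // v Cv; first by split; [apply: stb | apply: stNb].
  rewrite !Soc_lambdaE //; last exact: star_Soc.
  by case: (Soc_subgroup B) => _ _; apply; apply: star_Soc.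
by apply: sub_skew_brace_of_lambda => // u v Cu Cv; case: (CL u Cu v Cv).
Qed.

End SecondSocle.

(** * The action on the socle *)

Section ActionOnSocle.
Context {B : skewBraceType}.
Hypothesis hD : dedekind B.
Hypothesis hS : Soc2 B = [set: B].
Implicit Types (a b x y : B).

(** If m (b * b) = 0, then [lambda b] fixes g = m b, so the cyclic group of g is
   a sub-skew brace on which lambda is trivial, hence an ideal. *)
Lemma Soc_not_periodic :
  ~ periodic [set: B] -> exists2 x, Soc B x & ~ torsion x.
Proof.
move=> hnp; apply: contrapT => noS.
have tS x : Soc B x -> torsion x.
  by move=> Sx; apply: contrapT => tx; apply: noS; exists x.
apply: hnp => b _; apply: contrapT => tb.
have Ss := star_Soc hS b b; have [m m0 sm] := tS _ Ss.
pose g := b *~ m.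
have tg k : torsion (g *~ k) -> k = 0%R.
  rewrite -zmulMr => t; apply: contrapT => k0.
  by apply: tb; apply: (zmul_torsion t); nia.
have lg : lambda b g = g.
  rewrite (morph_zmul (lambdaD b)) lambdaE zmulDl; last exact: Soc_commute.
  by rewrite [star b b *~ m]sm mul1g.
have sg : sub_skew_brace (multiples g).
  apply: (sub_skew_brace_of_lambda hS); first exact: multiples_subgroup.
  move=> u _ gu [k _ <-]; rewrite (morph_zmul (lambdaD u)).
  suff -> : lambda u g = g by exists k.
  have sL : subgroup [set v | lambda v g = g].
    split=> [|v w Lv Lw|v Lv] /=; rewrite ?lambda0 ?(lambdaDl hS) ?Lw //.
    by rewrite -{1}Lv -(lambdaDl hS) mulVg lambda0.
  apply: (multiples_sub sL _ gu).
  by apply: (subgroup_zmul m sL).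
have ig := hD sg.
(* The ideal generated by g is torsion-free, whereas the socle is assumed to be
   periodic. *)
have g0 x : multiples g x -> Soc B x -> x = 0.
  by move=> [k _ <-] /tS /tg ->.
have gg := multiples_id g.
have Sg : Soc B g.
  split=> a.
    rewrite lambdaE (g0 (star g a)) ?mul1g //; last exact: star_Soc.
    exact: ideal_star_l.
  apply/commgP/eqP; apply: g0; [exact: ideal_commg | exact: commg_Soc].
by have := tg 1%R; rewrite zmul1 => /(_ (tS _ Sg)).
Qed.

(** Comparing the images of x, y and x + y under [lambda b], which are multiples
   of these elements, gives either the same coefficient or a nonzero multiple
   of x that is also a multiple of y; in the second case x and y are scaled
   alike as well. *)
Lemma power_automorphism b x c y :
  Soc B x -> ~ torsion x -> lambda b x = x *~ c ->
  Soc B y -> lambda b y = y *~ c.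
Proof.
move=> Sx tx Ex Sy; have lZ u k := morph_zmul (lambdaD b) u k.
have [k _ Ey] := lambda_multiples hD hS b Sy.
have Cxy : commute x y by apply: Soc_commute.
have [_ SD _] := Soc_subgroup B.
have [l _ Exy] := lambda_multiples hD hS b (SD _ _ Sx Sy).
have E : x *~ (l - c) = y *~ (k - l).
  move: Exy; rewrite /= zmulDl // lambdaD Ex -Ey => Exy.
  rewrite (GRing.addrC l) !zmulDr !zmulNr.
  apply: (mulgI (x *~ c)); rewrite mulVKg.
  by rewrite mulgA -Exy mulgK.
have [lc|lc] := eqVneq l c.
  move: E; rewrite -lc GRing.subrr zmulDr zmulNr => /esym/divg1_eq <-.
  by rewrite Ey.
have ty : ~ torsion y.
  move=> ty; apply: tx; apply: (@zmul_torsion _ x (l - c)%R); last by lia.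
  by rewrite E; apply: torsion_zmul.
have kl : (k - l <> 0)%R.
  move=> kl; apply: tx; apply/torsionP; exists (l - c)%R; first by lia.
  by rewrite E kl.
have E2 : y *~ ((k - l) * c) = y *~ ((k - l) * k).
  transitivity (lambda b (y *~ (k - l))); last first.
    by rewrite lZ -Ey (GRing.mulrC _ k) zmulMr.
  by rewrite zmulMr -E lZ Ex -!zmulMr (GRing.mulrC c).
by have := zmul_inj ty E2 => /(GRing.mulfI _) -> //; apply/eqP.
Qed.

(** The factor c by which [lambda b] multiplies the socle is an integer
   whose inverse is the factor of [lambda (- b)]; what has to be excluded
   is c = -1. *)
Lemma lambda_Soc b x :
  ~ periodic [set: B] -> Soc B x -> lambda b x = x.
Proof.
move=> hnp; have [z Sz tz] := Soc_not_periodic hnp.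
have [c _ Ec] := lambda_multiples hD hS b Sz.
have act y : Soc B y -> lambda b y = y *~ c.
  exact: (power_automorphism Sz tz (esym Ec)).
have [d _ Ed] := lambda_multiples hD hS (- b) Sz.
have dc : (d * c = 1)%R.
  apply: (zmul_inj tz); rewrite zmulMr Ed -(morph_zmul (lambdaD _)) Ec.
  by rewrite -(lambdaDl hS) mulVg lambda0.
have [c1|c1] : (c = 1 \/ c = -1)%R.
  have /eqP := congr1 absz dc; rewrite abszM muln_eq1 => /andP[_ /eqP].
  lia.
  by move=> Sx; rewrite act // c1.
exfalso; rewrite {}c1 in act => {Ec dc d Ed}.
have {act} act y : Soc B y -> lambda b y = - y.
  by move=> Sy; rewrite act // zmulNr.
(* Since w = star a y = - 2 y is negated by [lambda a] and w = n a + k s, the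
   element 4 y = - 2 w is the multiple n - 2 k of s. *)
have key a y : (forall u, lambda a u = lambda b u) -> Soc B y ->
    multiples (star a a) (y *~ 4).
  move=> ab Sy; have sC := gen_brace_subgroup hS a.
  have iC := gen_brace_ideal hD hS a.
  set s := star a a; set w := star a y.
  have Ss : Soc B s by apply: star_Soc.
  have Sw : Soc B w by apply: star_Soc.
  have Ey : w = - y - y by rewrite /w /star -/(lambda a y) ab act.
  have Ew : lambda a w = - w by rewrite ab act.
  have [n [k Enk]] : gen_brace a w.
    by apply: ideal_star_l => //; apply: gen_brace_id.
  have Ew2 : - w = s *~ n + a *~ n - s *~ k.
    rewrite -Ew {1}Enk lambdaD !(morph_zmul (lambdaD a)) lambdaE.
    rewrite zmulDl; last exact: Soc_commute.
    by rewrite [lambda a _]ab act // zmulNl.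
  exists (n + (- k - k))%R => //.
  transitivity (- w - w); last first.
    by rewrite Ey invgM invgK -mulgA.
  rewrite {1}Ew2 Enk invgM -!mulgA zmulDr; congr (_ * _)%g.
  have Ct : commute (s *~ (- k - k)) (a *~ n).
    by apply: Soc_commute; apply: Soc_zmul.
  rewrite (mulgA (- (s *~ k))) -zmulNr -zmulDr mulgA -/(commute _ _).
  by rewrite -Ct mulgK.
pose s := star b b; have Ss : Soc B s by apply: star_Soc.
have ts : ~ torsion s.
  move=> ts; have [k _ E] := key b z (fun=> erefl) Sz; apply: tz.
  by apply: (@zmul_torsion _ z 4) => //; rewrite -E; apply: torsion_zmul.
(* The choice y = 3 s makes the star square of b + y equal to - 5 s, and 4 s is
   not a multiple of it. *)
pose y := s *~ 3; have Sy : Soc B y by apply: Soc_zmul.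
have by_b u : lambda (b + y) u = lambda b u.
  by rewrite (lambdaDl hS) (Soc_lambdaE _ Sy).
have Es u : Soc B u -> star (b + u) (b + u) = s + (- u - u).
  move=> Su; rewrite /star -/(lambda _ _) (lambdaDl hS) (Soc_lambdaE _ Su).
  rewrite lambdaD lambdaE -/s act // invgM -(mulgA s) -mulgA; congr (_ * _)%g.
  have Cu : commute (- u - u) b.
    apply: Soc_commute; have [_ SD SN] := Soc_subgroup B.
    by apply: SD; apply: SN.
  by rewrite -mulgA (mulgA (- u)) mulgA -Cu mulgK.
have [k _] := key (b + y) s by_b Ss.
rewrite Es // -zmulNr -zmulDr -{1}(zmul1 s) -zmulDr -zmulMr => /(zmul_inj ts).
by lia.
Qed.

Lemma Soc_centre : ~ periodic [set: B] -> Soc B = centre B.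
Proof.
move=> hnp; apply/seteqP; split=> x; last by case.
move=> Sx; split=> // b; have [kx _] := Sx.
change (x ∘ (b : B) = (b : B) ∘ x).
by rewrite (ker_lambdaE _ kx) circE lambda_Soc // (Soc_commute _ Sx).
Qed.

End ActionOnSocle.

(** * The star product *)

Section StarProduct.
Context {B : skewBraceType}.
Hypothesis hD : dedekind B.
Hypothesis hS : Soc2 B = [set: B].
Hypothesis hnp : ~ periodic [set: B].
Implicit Types (a b c d x y : B).

Lemma star_Soc_l x b : Soc B x -> star x b = 0.
Proof. by move=> Sx; rewrite /star -/(lambda x b) Soc_lambdaE // mulgV. Qed.

Lemma star_Soc_r b x : Soc B x -> star b x = 0.
Proof. by move=> Sx; rewrite /star -/(lambda b x) lambda_Soc // mulgV. Qed.

Lemma starDl c : {morph (fun a => star a c) : a b / a + b}.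
Proof.
move=> a b; rewrite /= {1}/star -/(lambda _ c) (lambdaDl hS) (lambdaE b c).
have Sb := star_Soc hS b c.
rewrite lambdaD (lambda_Soc hD hS a hnp Sb) (lambdaE a c).
by rewrite -mulgA mulgK (Soc_commute _ Sb).
Qed.

Lemma starDr a : {morph star a : b c / b + c}.
Proof.
move=> b c; rewrite {1}/star -/(lambda a _) lambdaD (lambdaE a b) (lambdaE a c).
have Sc := star_Soc hS a c.
rewrite invgM -(mulgA (star a b)) (mulgA b) -(Soc_commute b Sc).
by rewrite -(mulgA (star a c)) -(mulgA (star a b)) -(mulgA (star a c)) mulgA
  -(mulgA b) mulVKg mulgV mulg1.
Qed.

Lemma commgDl c : {morph (fun a => [~ a, c]%g) : a b / a + b}.
Proof.
move=> a b; have Sa := commg_Soc hS a c.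
rewrite {1}/commg conjMg invgM -(mulgA b^-1%g) (mulgA a^-1%g) -/(commg a c).
by rewrite mulgA -(Soc_commute _ Sa) -mulgA.
Qed.

Lemma gen_brace_star_l a b : gen_brace a (star a b).
Proof.
by apply: ideal_star_l; [apply: (gen_brace_ideal hD hS) | apply: gen_brace_id].
Qed.

Lemma gen_brace_star_r a b : gen_brace b (star a b).
Proof.
by apply: ideal_star_r; [apply: (gen_brace_ideal hD hS) | apply: gen_brace_id].
Qed.

Lemma gen_brace_commg a b : gen_brace a [~ a, b]%g.
Proof.
by apply: ideal_commg; [apply: (gen_brace_ideal hD hS) | apply: gen_brace_id].
Qed.

(** If s = a * a had infinite order, no nonzero multiple of a would be in the
   socle. Then the socle part of [gen_brace (2 a)] consists of the multiples of
   (2 a) * (2 a) = 4 s, yet this ideal contains a * (2 a) = 2 s. *)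
Lemma torsion_star_diag a : torsion (star a a).
Proof.
apply: contrapT; set s := star a a => ts.
have fZ k : star a (a *~ k) = s *~ k by rewrite (morph_zmul (starDr a)).
have E4 : star (a *~ 2) (a *~ 2) = s *~ 4.
  rewrite (morph_zmul (starDr _)) (morph_zmul (starDl a)) -/s -zmulMr.
  by [].
have := gen_brace_star_r a (a *~ 2); rewrite fZ => -[n [k]]; rewrite E4 => E.
have n0 : (n = 0)%R.
  have := congr1 (star a) E.
  rewrite (starDr a (a *~ 2 *~ n)) !(morph_zmul (starDr a)).
  rewrite (star_Soc_r a (star_Soc hS a a)) !zmul0l mulg1 => /esym.
  rewrite -zmulMr -(zmul0 s) => /(zmul_inj ts); lia.
move: E; rewrite n0 mul1g -zmulMr => /(zmul_inj ts); lia.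
Qed.

(** Writing f a = n a + k (a * a) and applying f gives n (f a) = 0, so f a
   is torsion: if n = 0, it is a multiple of a * a. Adding to a an
   element y of the socle changes neither f a nor a * a. When a + y has
   infinite order, the relation f a = n (a + y) + k (a * a) between
   torsion elements forces n = 0. *)
Lemma multiples_star_diag (f : B -> B) a :
    {morph f : x y / x + y} -> (forall x, Soc B (f x)) ->
    (forall x, Soc B x -> f x = 0) -> (forall x, gen_brace x (f x)) ->
  multiples (star a a) (f a).
Proof.
move=> fD fS f0 fC; have ts := torsion_star_diag a.
have tf : torsion (f a).
  have [n [k E]] := fC a.
  have [n0|n0] := eqVneq n 0%R.
    by rewrite E n0 mul1g; apply: torsion_zmul.
  apply: (@zmul_torsion _ _ n); last exact/eqP.
  have := congr1 f E; rewrite fD !(morph_zmul fD).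
  rewrite (f0 _ (fS a)) (f0 _ (star_Soc hS a a)) zmul0l mulg1 => <-.
  exact: torsion0.
have [y Sy ty] : exists2 y, Soc B y & ~ torsion (a + y).
  have [ta|ta] := pselect (torsion a); last first.
    by exists 0; [case: (Soc_subgroup B) | rewrite mulg1].
  have [x Sx tx] := Soc_not_periodic hD hS hnp; exists x => // tax; apply: tx.
  rewrite -(mulKg a x); apply: torsionD => //; last exact: torsionN.
  apply: commute_sym; apply: commuteV; apply: commute_sym.
  by apply: commuteM => //; apply: commute_sym; apply: Soc_commute.
have [n [k]] := fC (a + y).
rewrite fD (f0 _ Sy) starDl !starDr.
rewrite !(star_Soc_l _ Sy) (star_Soc_r _ Sy) !mulg1.
have [-> E|n0 E] := eqVneq n 0%R; first by exists k; rewrite // E mul1g.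
exfalso; apply: ty; apply: (@zmul_torsion _ _ n); last exact/eqP.
rewrite -(mulgK (star a a *~ k) (_ *~ n)) -E; apply: torsionD => //.
  exact: Soc_commute.
by apply: torsionN; apply: torsion_zmul.
Qed.

Lemma multiples_star_l a b : multiples (star a a) (star a b).
Proof.
apply: (@multiples_star_diag (fun a => star a b)); [exact: starDl | | | ] => x.
- exact: star_Soc.
- exact: star_Soc_l.
- exact: gen_brace_star_l.
Qed.

Lemma multiples_star_r a b : multiples (star b b) (star a b).
Proof.
apply: multiples_star_diag; [exact: starDr | | | ] => x.
- exact: star_Soc.
- exact: star_Soc_r.
- exact: gen_brace_star_r.
Qed.

Lemma multiples_commg a b : multiples (star a a) [~ a, b]%g.
Proof.
apply: (@multiples_star_diag (fun a => [~ a, b]%g));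
  [exact: commgDl | | | ] => x.
- exact: commg_Soc.
- by move=> Sx; apply/eqP/commgP; apply: Soc_commute.
- exact: gen_brace_commg.
Qed.

(** If a * b = k (b * b), then d = a + (1 - k) b satisfies d * b = b * b
   and a * d = a * a + k (1 - k) (b * b). Both left-hand sides are
   multiples of d * d. *)
Lemma star_diag_directed a b :
  exists d, multiples (star d d) (star a a) /\ multiples (star d d) (star b b).
Proof.
have [k _ Ek] := multiples_star_r a b.
pose d := a + b *~ (1 - k); exists d.
have sd := multiples_subgroup (star d d); have [_ dD dN] := sd.
have db : multiples (star d d) (star b b).
  have -> : star b b = star d b; last exact: multiples_star_l.
  rewrite starDl (morph_zmul (starDl b)) -Ek -zmulDr.
  by rewrite GRing.addrCA GRing.subrr GRing.addr0.
split=> //.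
have -> : star a a = star a d - star b b *~ (k * (1 - k)).
  by rewrite starDr (morph_zmul (starDr a)) -Ek zmulMr mulgK.
by apply: dD; [apply: multiples_star_r | apply: dN; apply: subgroup_zmul].
Qed.

Lemma star_sub_multiple x : star_sub B x -> exists d, multiples (star d d) x.
Proof.
move: x; apply: (@generated_min _ _ [set x | exists d, multiples (star d d) x]).
  split; first by exists 0; case: (multiples_subgroup (star (0 : B) 0)).
  - move=> x y [a ax] [b by_]; have [d [da db]] := star_diag_directed a b.
    by exists d; have [_ mD _] := multiples_subgroup (star d d); apply: mD;
      [apply: (multiples_sub _ da ax) | apply: (multiples_sub _ db by_)];
      apply: multiples_subgroup.
  - move=> x [d dx]; exists d.
    by case: (multiples_subgroup (star d d)) => _ _; apply.
by move=> _ [[a b] _ <-]; exists a; apply: multiples_star_l.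
Qed.

Lemma star_sub_periodic : periodic (star_sub B).
Proof.
move=> x /star_sub_multiple[d [k _ <-]].
exact: torsion_zmul (torsion_star_diag d).
Qed.

Lemma star_sub_directed x y : star_sub B x -> star_sub B y ->
  exists2 z, star_sub B z & multiples z x /\ multiples z y.
Proof.
move=> /star_sub_multiple[a ax] /star_sub_multiple[b by_].
have [d [da db]] := star_diag_directed a b; exists (star d d).
  exact: star_sub_star.
have sd := multiples_subgroup (star d d).
by split; [apply: (multiples_sub sd da ax) | apply: (multiples_sub sd db by_)].
Qed.

End StarProduct.

(** * The second centre and the embedding *)

Section Embedding.
Context {B : skewBraceType}.
Hypothesis hD : dedekind B.
Hypothesis hS : Soc2 B = [set: B].
Hypothesis hnp : ~ periodic [set: B].
Implicit Types (a b x y : B).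

(** The socle is the centre, and modulo it star products and commutators
   vanish. *)
Lemma centre2_full : centre2 B = [set: B].
Proof.
apply/seteqP; split=> // a _.
have [qD qC] := quo_hom (centre_ideal B).
have zq x : Soc B x -> quo (centre_ideal B) x = 0.
  by move=> Sx; apply/quo_eq0; rewrite -Soc_centre.
have triv : trivial_skew_brace (quotient (centre_ideal B)).
  by apply: quo_trivial => u v; rewrite -Soc_centre //; apply: star_Soc.
have com b : commute (quo (centre_ideal B) a) (quo (centre_ideal B) b).
  rewrite /commute -!qD (commgC a b) (qD (b + a)) (zq _ (commg_Soc hS a b)).
  by rewrite mulg1.
split; first split; elim/quoP=> b.
- by rewrite /lambda -triv mulKg.
- exact: com.
- change (quo (centre_ideal B) a ∘ quo (centre_ideal B) b =
    quo (centre_ideal B) b ∘ quo (centre_ideal B) a).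
  by rewrite -!triv com.
Qed.

(** An integer m with m (a * a) = 0 also kills each [star a b] and [~ a, b], as
   these are multiples of a * a. *)
Lemma zmul_in_Soc a : exists2 m : int, m <> 0%R & Soc B (a *~ m).
Proof.
have /torsionP[m m0 sm] := torsion_star_diag hD hS hnp a.
have kill x : multiples (star a a) x -> x *~ m = 0.
  by move=> [k _ <-]; rewrite -zmulMr GRing.mulrC zmulMr sm zmul0l.
exists m => //; split=> b.
  rewrite lambdaE (morph_zmul (starDl hD hS hnp b)) kill ?mul1g //.
  exact: multiples_star_l.
apply/commgP/eqP; rewrite (morph_zmul (commgDl hS b)).
by apply: kill; apply: multiples_commg.
Qed.

Lemma torsion_commg a b : torsion [~ a, b]%g.
Proof.
have [k _ <-] := multiples_commg hD hS hnp a b.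
by apply: torsion_zmul; apply: torsion_star_diag.
Qed.

(** The collection formula in a group with central commutators; the exact
   exponent is the binomial coefficient of n and 2, but any multiple of a
   torsion commutator serves. *)
Lemma zmulD_class2 x y n :
  exists k, (x + y) *~ Posz n = x *~ n + y *~ n + [~ y, x]%g *~ k.
Proof.
elim: n => [|n [k IHn]]; first by exists 0%R; rewrite /= !mulg1.
exists (n%:Z + k)%R; have St j : Soc B ([~ y, x]%g *~ j).
  by apply: Soc_zmul; apply: commg_Soc.
have S1 z j : z *~ (j.+1)%:Z = z *~ j + z by rewrite /= expgSr.
rewrite S1 IHn !S1 zmulDr.
have QX : y *~ n + x = x + y *~ n + [~ y, x]%g *~ n.
  by rewrite (commgC (y *~ n) x) (morph_zmul (commgDl hS x)).
have cZ v : commute ([~ y, x]%g *~ k) v by apply: Soc_commute.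
have cW : commute ([~ y, x]%g *~ n) y by apply: Soc_commute.
move: QX cZ cW; generalize (x *~ n) (y *~ n) => P Q.
generalize ([~ y, x]%g *~ n) ([~ y, x]%g *~ k) => W Z QX cZ cW.
rewrite -(mulgA (P + Q) Z) (cZ (x + y)) !mulgA; congr (_ * _)%g.
by rewrite -(mulgA P Q x) QX !mulgA -(mulgA _ W y) cW mulgA.
Qed.

Lemma torsion_ideal : ideal [set x : B | torsion x].
Proof.
apply: hD; apply: (sub_skew_brace_of_lambda hS); last first.
  move=> u v _ /torsionP[k k0 vk]; apply/torsionP; exists k => //.
  by rewrite -(morph_zmul (lambdaD u)) vk lambda_r0.
split; [exact: torsion0 | | exact: torsionN].
move=> x y [n n0 xn] [m m0 ym].
have [k E] := zmulD_class2 x y (n * m).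
have E0 : (x + y) *~ (n * m)%N%:Z = [~ y, x]%g *~ k.
  by rewrite E /= expgnA xn mulnC expgnA ym !expg1n !mul1g.
apply: (@zmul_torsion _ _ (n * m)%N); last by nia.
by rewrite E0; apply: torsion_zmul; apply: torsion_commg.
Qed.

(** The two factors are B/J and B/I, with J the ideal of torsion elements and I
   a maximal torsion-free subgroup of the socle. *)
Lemma embedding_torsion_free_periodic :
  exists (S T : skewBraceType) (f : B -> (S * T)%type),
    [/\ embedding f, periodic [set: T], locally_cyclic (star_sub T),
        trivial_skew_brace S & torsion_free [set: S]].
Proof.
have [I [sI IS It Imax]] := torsion_complement (Soc_subgroup B)
  (fun x y Sx _ => Soc_commute y Sx).
have iI : ideal I by apply: hD; apply: sub_skew_brace_Soc.
pose iJ := torsion_ideal.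
have [qD qC] := quo_hom iJ; have [rD rC] := quo_hom iI.
exists (quotient iJ), (quotient iI), (fun x => (quo iJ x, quo iI x)); split.
- split; first split=> x y.
  + by rewrite qD rD.
  + by rewrite qC rC.
  + move=> x y [/quo_eq Jxy /quo_eq Ixy].
    by rewrite -(mulVKg x y) (It _ Ixy Jxy) mulg1.
- elim/quoP=> x _; apply/torsionP.
  have [m m0 /Imax[n n0 In]] := zmul_in_Soc x.
  exists (m * n)%R; first by nia.
  by rewrite -quo_zmul zmulMr; apply/quo_eq0.
- apply: locally_cyclic_directed.
    by have [] := @star_sub_subgroup (quotient iI).
  move=> _ _ /star_sub_quo_lift[x Sx ->] /star_sub_quo_lift[y Sy ->].
  have [z Sz [zx zy]] := star_sub_directed hD hS hnp Sx Sy.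
  exists (quo iI z); first exact: star_sub_quo.
  by split; apply: (morph_multiples rD).
- apply: quo_trivial => a b; have [k _ <-] := multiples_star_l hD hS hnp a b.
  by apply: torsion_zmul; apply: torsion_star_diag.
- elim/quoP=> x n _ n0 xn; apply/quo_eq0.
  have : torsion (x *~ n).
    by apply: (quo_eq0 iJ _).1; rewrite quo_zmul.
  by move=> /zmul_torsion; apply; lia.
Qed.

End Embedding.

Unset Implicit Arguments.

Theorem corollary3p12 (B : skewBraceType)
    (hD : dedekind B)
    (hSoc2 : Soc2 B = [set: B])
    (hnp : ~ periodic [set: B]) :
  (Soc B = centre B /\ centre2 B = [set: B]) /\
  (locally_cyclic (star_sub B) /\ periodic (star_sub B)) /\
  (exists (S T : skewBraceType) (f : B -> (S * T)%type),
     [/\ embedding f,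
         periodic [set: T],
         locally_cyclic (star_sub T),
         trivial_skew_brace S
       & torsion_free [set: S]]).
Proof.
split; [split; [exact: Soc_centre | exact: centre2_full] | split; [split|]].
- apply: locally_cyclic_directed; first by have [] := @star_sub_subgroup B.
  exact: star_sub_directed.
- exact: star_sub_periodic.
- exact: embedding_torsion_free_periodic.
Qed.
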